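(* Let $\mathcal{M}_1=(V,\mathcal{I}_1),\dots,\mathcal{M}_k=(V,\mathcal{I}_k)$ be $k$ matroids on a common ground set $V$ with $|V|=n$, each accessible only through a rank oracle, and let $p$ be the maximum cardinality of a partitionable set. There is an algorithm that finds a partitionable set of cardinality $p$ using $O\big((n+k)\sqrt{p}\log n\big)$ rank oracle queries.
   Context: A set $S\subseteq V$ is partitionable if there is a partition $(S_1,\dots,S_k)$ of $S$ with $S_i\in\mathcal{I}_i$ for all $i\in[k]$. A rank oracle for $\mathcal{M}_i$ takes $X\subseteq V$ and returns $\mathrm{rank}_{\mathcal{M}_i}(X)=\max\{|Y|: Y\subseteq X, Y\in\mathcal{I}_i\}$; the query complexity counts the total number of oracle calls over all $k$ matroids.
   Formalization: In the query bound, p is replaced by max(p,1) and n inside the logarithm by max(n,2), since the stated bound is zero when p = 0 or n = 1, although queries are needed there; for p ≥ 1 and n ≥ 2 the bound is as stated. *)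

(* Defs.v *)
From mathcomp Require Import all_boot.

Set Implicit Arguments.
Unset Strict Implicit.
Unset Printing Implicit Defensive.

Record matroid (V : finType) := Matroid {
  indep : {set {set V}};
  indep_set0 : set0 \in indep;
  indep_sub : forall X Y : {set V},
    Y \in indep -> X \subset Y -> X \in indep;
  indep_augment : forall X Y : {set V},
    X \in indep -> Y \in indep -> #|X| < #|Y| ->
    exists2 x, x \in Y :\: X & x |: X \in indep
}.

Definition rank (V : finType) (M : matroid V) (X : {set V}) : nat :=
  \max_(Y : {set V} | (Y \subset X) && (Y \in indep M)) #|Y|.

(* The parts of the partition are indexed by 'I_k and may be empty. *)
Definition partitionable (V : finType) (k : nat) (M : 'I_k -> matroid V)
    (S : {set V}) : bool :=
  [exists P : {ffun 'I_k -> {set V}},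
    [&& \bigcup_(i < k) P i == S,
        [forall i, forall j, (i != j) ==> [disjoint P i & P j]]
      & [forall i, P i \in indep (M i)]]].

Definition max_partitionable (V : finType) (k : nat)
    (M : 'I_k -> matroid V) : nat :=
  \max_(S : {set V} | partitionable M S) #|S|.

(* Deterministic adaptive query algorithms, as decision trees: [Query i X f]
   asks the i-th oracle for the rank of X and proceeds with [f r] on answer r.
   A tree depends on V and k only, so that the matroids can be accessed only
   through the answers. *)
Inductive rank_algorithm (V : finType) (k : nat) : Type :=
| Return of {set V}
| Query of 'I_k & {set V} & (nat -> rank_algorithm V k).

Fixpoint output (V : finType) (k : nat) (M : 'I_k -> matroid V)
    (A : rank_algorithm V k) : {set V} :=
  match A with
  | Return X => X
  | Query i X f => output M (f (rank (M i) X))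
  end.

Fixpoint num_queries (V : finType) (k : nat) (M : 'I_k -> matroid V)
    (A : rank_algorithm V k) : nat :=
  match A with
  | Return _ => 0
  | Query i X f => (num_queries M (f (rank (M i) X))).+1
  end.

(* Main.v *)
(* The elements get levels, 0 on the uncovered ones, such that every element of
   level < t is spanned in M_i by the elements of level <= t of the i-th part,
   for all t up to a bound that grows with the phase m. Filling a free place of
   level j of M_i with an element of smaller level raises that element to level
   j and vacates its old place, of smaller level, in another part. Levels and
   free places only move up, so m phases cost O((n + k) m log n) queries, the
   elements to move being found by bisection. After phase m, duality applied to the set
   {level < t} for t = 1, ..., m gives p <= |S| + #{v in S | level v = t};
   averaging over t shows p - |S| <= m as soon as |S| <= m^2, so m = O(sqrt p)
   phases suffice. The O(sqrt p) missing elements are then gained one by one: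
   a search from the free places backwards sees each element with O(log n)
   queries, and an augmenting path is followed from the last element seen. *)
Require Import Defs.
From mathcomp Require Import all_boot all_order all_algebra.
From mathcomp Require Import reals exp.
From mathcomp Require Import zify ring.
Import Order.TTheory GRing.Theory Num.Theory.

Set Implicit Arguments.
Unset Strict Implicit.
Unset Printing Implicit Defensive.

(** * Independent sets and spans *)


Section Spanning.

Variables (V : finType) (M : matroid V).
Implicit Types (A I J K X Y : {set V}) (u v w x y : V).

(** For independent [J] this is membership in the closure of [J]. *)
Definition spanned J u := (u \in J) || (u |: J \notin indep M).

Lemma not_spanned J u : ~~ spanned J u -> u \notin J /\ u |: J \in indep M.
Proof. by rewrite negb_or negbK => /andP. Qed.

Lemma leq_card_spanned J K :
  J \in indep M -> K \in indep M -> {in K, forall x, spanned J x} ->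
  #|K| <= #|J|.
Proof.
move=> iJ iK sp; rewrite leqNgt; apply/negP => ltJK.
have [x] := indep_augment iJ iK ltJK.
rewrite inE => /andP[xJ xK] ixJ; have := sp x xK.
by rewrite /spanned (negbTE xJ) ixJ.
Qed.

(** [K] is a basis of the span of [J]: if [u |: K] were independent, it would be spanned by [J] and
    have more elements than [J]. *)
Lemma spanned_trans J K u :
  J \in indep M -> K \in indep M -> #|J| <= #|K| ->
  {in K, forall x, spanned J x} -> spanned J u -> spanned K u.
Proof.
move=> iJ iK leJK sp spu; apply/negPn/negP => /not_spanned[uK iuK].
have: #|u |: K| <= #|J|.
  by apply: leq_card_spanned => // x /setU1P[->|/sp].
by rewrite cardsU1 uK add1n ltnNge leJK.
Qed.

Lemma indep_extend X Y :
  X \in indep M -> Y \in indep M -> #|X| <= #|Y| ->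
  exists Z, [/\ Z \in indep M, X \subset Z, Z \subset X :|: Y & #|Z| = #|Y|].
Proof.
move=> iX iY; have [d] := ubnP (#|Y| - #|X|).
elim: d X iX => // d IH X iX ltd leXY.
have [eqXY|ltXY] := eqVneq #|X| #|Y|; first by exists X; rewrite subsetUl.
have {}ltXY : #|X| < #|Y| by rewrite ltn_neqAle ltXY.
have [x] := indep_augment iX iY ltXY; rewrite inE => /andP[xX xY] ixX.
have cx : #|x |: X| = #|X|.+1 by rewrite cardsU1 xX.
have [||Z [iZ sZ Zs cZ]] := IH _ ixX; [by rewrite cx; lia | by rewrite cx|].
exists Z; split=> //; first by apply: subset_trans sZ; apply: subsetUr.
by apply: subset_trans Zs _; rewrite -setUA subUset sub1set inE xY orbT /=.
Qed.

(** Extend [w |: A] inside [w |: (g |: I)] to size [#|I| + 1]. The result avoids [g], since [g |: A]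
    spans [w], so it is [w |: I]. *)
Lemma indep_swap I A g w :
  A \subset I -> g |: I \in indep M -> g \notin I -> w \notin I ->
  ~~ spanned A w -> spanned (g |: A) w -> w |: I \in indep M.
Proof.
move=> sAI igI gI wI /not_spanned[wA iwA] spw.
have [->//|neq_wg] := eqVneq w g.
have [|Z [iZ sZ Zs cZ]] := indep_extend iwA igI.
  by rewrite !cardsU1 wA gI leq_add2l subset_leq_card.
have gZ : g \notin Z.
  apply/negP => gZ; move: spw; rewrite /spanned !inE (negbTE neq_wg) (negbTE wA) /=.
  rewrite (indep_sub iZ) // !subUset !sub1set gZ andbC /=.
  by move: sZ; rewrite subUset sub1set andbC.
suff -> : w |: I = Z by [].
apply/esym/eqP; rewrite eqEcard cZ !cardsU1 gI wI leqnn andbT.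
apply/subsetP => z zZ; have := subsetP Zs z zZ.
rewrite !inE -orbA => /or4P[->//|/(subsetP sAI)->|/eqP zg|->]; rewrite ?orbT //.
by rewrite zg (negbTE gZ) in zZ.
Qed.

(** Extend [x |: (I :\: (y |: X))] by elements of [I] to size [#|I|]. The result misses one element
    of [x |: I]; were [y] present, it would contain the dependent set [x |: (I :\: X)]. *)
Lemma indep_exchange I X y x :
  I \in indep M -> x \notin I -> y \in I ->
  x |: (I :\: (y |: X)) \in indep M -> x |: (I :\: X) \notin indep M ->
  x |: (I :\ y) \in indep M.
Proof.
move=> iI xI yI i1 i2.
have xE (B : {set V}) : x \notin I :\: B by rewrite inE (negbTE xI) andbF.
have [|Z [iZ sZ Zs cZ]] := indep_extend i1 iI.
  rewrite cardsU1 xE add1n (cardsD1 y I) yI add1n ltnS subset_leq_card //.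
  apply/subsetP => z; rewrite !inE negb_or -andbA => /and3P[-> _ ->] //.
have xZ : x \in Z by apply: (subsetP sZ); rewrite !inE eqxx.
have ZI : Z \subset x |: I.
  apply: subset_trans Zs _; apply/subsetP => z; rewrite !inE -orbA.
  by case/or3P=> [->|/andP[_ ->]|->]; rewrite ?orbT.
have [yZ|yZ] := boolP (y \in Z); last first.
  suff -> : x |: I :\ y = Z by [].
  apply/esym/eqP; rewrite eqEcard cZ cardsU1 xE add1n (cardsD1 y I) yI leqnn andbT.
  apply/subsetP => z zZ; have := subsetP ZI z zZ; rewrite !inE.
  case/orP=> [->//|->]; rewrite andbT; apply/orP; right.
  by apply: contraNneq yZ => <-.
have : #|(x |: I) :\: Z| <= 1.
  rewrite cardsDS // cardsU1 xI cZ; lia.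
case/negP: i2; apply: indep_sub iZ _.
rewrite subUset sub1set xZ /=; apply/subsetP => z.
rewrite !inE => /andP[zX zI].
have [->//|neq_zy] := eqVneq z y.
by apply: (subsetP sZ); rewrite !inE negb_or neq_zy zX zI orbT.
Qed.

(** The exchanged set without [R] spans [y] because [x |: (I :\: R)] is dependent. Hence it spans
    [I :\: R], and being no larger it has the same span. *)
Lemma spanned_exchange I (R : {set V}) x y u :
  I \in indep M -> x \notin I -> y \in I -> x \notin R -> y \notin R ->
  x |: (I :\ y) \in indep M -> x |: (I :\: R) \notin indep M ->
  spanned ((x |: (I :\ y)) :\: R) u -> spanned (I :\: R) u.
Proof.
move=> iI xI yI xR yR i1 i2; set J := _ :\: R.
have defJ : J = x |: ((I :\: R) :\ y).
  apply/setP => z; rewrite !inE; have [->|_] := eqVneq z x; first by rewrite xR.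
  by case: (z == y); case: (z \in R).
have yK : y \in I :\: R by rewrite inE yR.
have xK : x \notin I :\: R by rewrite inE (negbTE xI) andbF.
apply: spanned_trans.
- by apply: indep_sub i1 _; apply: subsetDl.
- by apply: indep_sub iI _; apply: subsetDl.
- by rewrite defJ cardsU1 (cardsD1 y (I :\: R)) yK leq_add2r leq_b1.
move=> z zK; have [->|neq_zy] := eqVneq z y; last first.
  by rewrite /spanned defJ setU1r // !in_setD1 neq_zy.
suff e : y |: J = x |: (I :\: R) by rewrite /spanned e i2 orbT.
by rewrite defJ setUCA setD1K.
Qed.

(** In terms of circuits: for [u] outside [I], the circuit of [u |: I] avoids each [v] for which
    [I :\ v] still spans [u], hence avoids [X]. Removing single elements thus suffices as a test,
    which keeps the number of sets to search linear. *)
Lemma spanned_setD I X u :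
  I \in indep M -> spanned I u -> {in I :&: X, forall v, spanned (I :\ v) u} ->
  u \notin X ->
  spanned (I :\: X) u.
Proof.
move=> iI spu sp uX; apply/negPn/negP => /not_spanned[uIX iu].
have uI : u \notin I by move: uIX; rewrite inE uX.
have iuI : u |: I \notin indep M by move: spu; rewrite /spanned (negbTE uI).
have [|Z [iZ sZ Zs cZ]] := indep_extend iu iI.
  rewrite leqNgt; apply: contra iuI => lt.
  suff -> : u |: I = u |: I :\: X by [].
  apply/esym/eqP; rewrite eqEcard setUS ?subsetDl //=.
  by rewrite (cardsU1 u I) uI add1n.
have uZ : u \in Z by apply: (subsetP sZ); rewrite !inE eqxx.
have ZI : Z \subset u |: I.
  by apply: subset_trans Zs _; rewrite subUset setUS ?subsetDl //= subsetUr.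
have [v vI vZ] : exists2 v, v \in I & v \notin Z.
  apply/exists_inP; rewrite -negb_forall_in; apply: contra iuI => /forall_inP IZ.
  apply: indep_sub iZ _; rewrite subUset sub1set uZ; exact/subsetP.
have vX : v \in X.
  by apply: contraNT vZ => vX; apply: (subsetP sZ); rewrite !inE vX vI orbT.
have := sp v; rewrite inE vI vX => /(_ isT).
rewrite /spanned !inE (negbTE uI) andbF /= => /negP; apply.
suff <- : Z = u |: I :\ v by [].
apply/eqP; rewrite eqEcard cZ cardsU1 (cardsD1 v I) vI !inE (negbTE uI) andbF leqnn andbT.
apply/subsetP => z zZ; have := subsetP ZI z zZ; rewrite !inE.
case/orP=> [->//|->]; rewrite andbT; apply/orP; right.
by apply: contraNneq vZ => <-.
Qed.

Lemma rank_witness X :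
  exists Y, [/\ Y \subset X, Y \in indep M & rank M X = #|Y|].
Proof.
pose P := [pred Y : {set V} | (Y \subset X) && (Y \in indep M)].
have [|Y /andP[sY iY] e] := @eq_bigmax_cond _ P (fun Y => #|Y|).
  by apply/card_gt0P; exists set0; rewrite !inE sub0set indep_set0.
by exists Y; split=> //; rewrite -e; apply: eq_bigl => Z; rewrite !inE.
Qed.

Lemma leq_card_rank X Y : Y \subset X -> Y \in indep M -> #|Y| <= rank M X.
Proof.
by move=> sY iY; rewrite /rank (leq_bigmax_cond (F := fun Y => #|Y|)) ?sY.
Qed.

(** One query decides whether [K] spans all of [X]; bisection repeats this test. *)
Lemma rank_gt K X :
  K \in indep M -> (#|K| < rank M (K :|: X)) = [exists x in X, ~~ spanned K x].
Proof.
move=> iK; apply/idP/exists_inP => [|[x xX /not_spanned[xK ixK]]].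
  have [Y [sY iY ->] lt] := rank_witness (K :|: X).
  have [x] := indep_augment iK iY lt.
  rewrite inE => /andP[xK /(subsetP sY)]; rewrite inE (negbTE xK) /= => xX ixK.
  by exists x => //; rewrite /spanned (negbTE xK) ixK.
have -> : #|K|.+1 = #|x |: K| by rewrite cardsU1 xK.
by rewrite leq_card_rank // subUset sub1set inE xX orbT subsetUl.
Qed.

Lemma rank_eq_card X : (rank M X == #|X|) = (X \in indep M).
Proof.
apply/idP/idP => [|iX].
  have [Y [sY iY ->]] := rank_witness X => /eqP eYX.
  by suff <- : Y = X by []; apply/eqP; rewrite eqEcard sY eYX leqnn.
rewrite eqn_leq leq_card_rank // andbT.
by have [Y [sY _ ->]] := rank_witness X; apply: subset_leq_card.
Qed.

End Spanning.

(** * Query programs *)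


(** Decision trees with results of any type, so that [bind] can compose subroutines; [compile] turns
    the finished one into a [rank_algorithm]. *)
Inductive prog (V : finType) (k : nat) (T : Type) : Type :=
| Ret of T
| Ask of 'I_k & {set V} & (nat -> prog V k T).

Arguments Ret {V k T}.
Arguments Ask {V k T}.

Fixpoint bind (V : finType) k A B (p : prog V k A) (h : A -> prog V k B) :=
  match p with
  | Ret a => h a
  | Ask i X f => Ask i X (fun r => bind (f r) h)
  end.

Fixpoint value (V : finType) k (M : 'I_k -> matroid V) A (p : prog V k A) : A :=
  match p with
  | Ret a => a
  | Ask i X f => value M (f (rank (M i) X))
  end.

Fixpoint cost (V : finType) k (M : 'I_k -> matroid V) A (p : prog V k A) : nat :=
  match p with
  | Ret _ => 0
  | Ask i X f => (cost M (f (rank (M i) X))).+1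
  end.

Fixpoint compile (V : finType) k (p : prog V k {set V}) : rank_algorithm V k :=
  match p with
  | Ret X => Return k X
  | Ask i X f => Query i X (fun r => compile (f r))
  end.

Fixpoint loop (V : finType) k St (fuel : nat) (step : St -> prog V k (option St))
    (st : St) : prog V k St :=
  if fuel is fuel'.+1 then
    bind (step st) (fun o => if o is Some st' then loop fuel' step st' else Ret st)
  else Ret st.

Section Programs.

Variables (V : finType) (k : nat) (M : 'I_k -> matroid V).

Lemma value_bind A B (p : prog V k A) (h : A -> prog V k B) :
  value M (bind p h) = value M (h (value M p)).
Proof. by elim: p => //= i X f IH. Qed.

Lemma cost_bind A B (p : prog V k A) (h : A -> prog V k B) :
  cost M (bind p h) = cost M p + cost M (h (value M p)).
Proof. by elim: p => //= i X f ->. Qed.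

Lemma output_compile p : output M (compile p) = value M p.
Proof. by elim: p => //= i X f IH. Qed.

Lemma num_queries_compile p : num_queries M (compile p) = cost M p.
Proof. by elim: p => //= i X f ->. Qed.

(** Amortized analysis: each continuing step lowers the potential [mu] by at least its cost and by
    at least one, so fuel above the initial potential does not run out before the loop stops. *)
Lemma loopP St (step : St -> prog V k (option St)) (inv Q : St -> Prop)
    (mu : St -> nat) fuel st :
  (forall s, inv s ->
     if value M (step s) is Some s' then
       [/\ inv s', mu s' < mu s & mu s' + cost M (step s) <= mu s]
     else Q s /\ cost M (step s) <= mu s) ->
  inv st -> mu st < fuel ->
  Q (value M (loop fuel step st)) /\ cost M (loop fuel step st) <= mu st.
Proof.
move=> stepP; elim: fuel st => // fuel IH st ist lt /=.
have := stepP st ist; rewrite value_bind cost_bind.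
case: (value M (step st)) => [s' [is' lt' le']|[qst le]] /=; last by rewrite addn0.
have [|q' c'] := IH s' is'; first by apply: leq_trans lt' _; rewrite -ltnS.
by split=> //; lia.
Qed.

End Programs.

(** * Finding an unspanned element by bisection *)

Section Search.

Variables (V : finType) (k : nat).
Implicit Types (i : 'I_k) (K X : {set V}).

(** Meant for [s] known to contain an unspanned element: testing the first half alone then tells
    which half to keep. *)
Fixpoint bisect i K d (s : seq V) : prog V k (option V) :=
  if d is d'.+1 then
    Ask i (K :|: [set x in take (2 ^ d') s])
      (fun r => if #|K| < r then bisect i K d' (take (2 ^ d') s)
                else bisect i K d' (drop (2 ^ d') s))
  else Ret (ohead s).

Definition depth := up_log 2 #|V|.

(** The first query settles failure, so a failing search costs one query and only a successful one
    pays for the bisection. *)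
Definition search i K X : prog V k (option V) :=
  Ask i (K :|: X)
    (fun r => if #|K| < r then bisect i K depth (enum X) else Ret None).

Variable M : 'I_k -> matroid V.

Lemma cost_bisect i K d s : cost M (bisect i K d s) = d.
Proof. by elim: d s => //= d IH s; case: ifP => _; rewrite IH. Qed.

Lemma bisectP i K d s :
  K \in indep (M i) -> size s <= 2 ^ d -> has (predC (spanned (M i) K)) s ->
  exists x, [/\ value M (bisect i K d s) = Some x, x \in s & ~~ spanned (M i) K x].
Proof.
move=> iK; elim: d s => [|d IH] s /=.
  by case: s => [|x []] //= _; rewrite orbF => nx; exists x; rewrite mem_head.
move=> sz hs; rewrite rank_gt //; case: exists_inP => [[x]|no].
  rewrite inE => xs nx; case: (IH (take (2 ^ d) s)).
  - by rewrite size_take_min geq_minl.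
  - by apply/hasP; exists x.
  - by move=> y [-> /mem_take ys ny]; exists y.
case: (IH (drop (2 ^ d) s)).
- by rewrite size_drop; move: sz; rewrite expnS; lia.
- move: hs; rewrite -{1}(cat_take_drop (2 ^ d) s) has_cat => /orP[/hasP[x xs nx]|//].
  by case: no; exists x; rewrite ?inE.
- by move=> y [-> /mem_drop ys ny]; exists y.
Qed.

Lemma searchP i K X : K \in indep (M i) ->
  if value M (search i K X) is Some x then
    [/\ x \in X, ~~ spanned (M i) K x & cost M (search i K X) = depth.+1]
  else {in X, forall x, spanned (M i) K x} /\ cost M (search i K X) = 1.
Proof.
move=> iK /=; rewrite rank_gt //; case: exists_inP => [[x xX nx]|no].
  have [||y [-> yX ny]] := @bisectP i K depth (enum X) iK.
  - rewrite -cardE (leq_trans (max_card _)) // /depth.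
    have [le1|lt1] := leqP #|V| 1; first by apply: leq_trans le1 _; rewrite expn_gt0.
    exact: up_logP.
  - by apply/hasP; exists x; rewrite ?mem_enum.
  by rewrite cost_bisect -mem_enum.
by split=> //= x xX; apply/negPn/negP => nx; apply: no; exists x.
Qed.

End Search.

(** * Assignments and augmenting paths *)


Lemma sum_card_leq (I T : finType) (F : I -> {set T}) (X : {set T}) :
  (forall i, F i \subset X) ->
  (forall i j x, x \in F i -> x \in F j -> i = j) ->
  \sum_i #|F i| <= #|X|.
Proof.
move=> sF dF.
have -> : \sum_i #|F i| = \sum_(x in X) \sum_i (x \in F i).
  rewrite exchange_big; apply: eq_bigr => i _.
  rewrite -sum1_card big_mkcond [RHS]big_mkcond; apply: eq_bigr => x _ /=.
  by case: (boolP (x \in F i)) => [/(subsetP (sF i)) ->|] //; case: ifP.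
rewrite -sum1_card; apply: leq_sum => x _.
case: (pickP (fun i => x \in F i)) => [i xi|no]; last by rewrite big1 // => i _; rewrite no.
rewrite (bigD1 i) //= big1 ?addn0 ?leq_b1 // => j /eqP neq_ji.
by case: (boolP (x \in F j)) => // xj; case: neq_ji; apply: dF xj xi.
Qed.

Lemma card_bigcup_leq (I T : finType) (F : I -> {set T}) :
  #|\bigcup_i F i| <= \sum_i #|F i|.
Proof.
apply: (big_ind2 (fun (X : {set T}) n => #|X| <= n)) => [|X m Y n le1 le2|//].
  by rewrite cards0.
by apply: leq_trans (leq_card_setU _ _) (leq_add le1 le2).
Qed.

Section Assignments.

Variables (V : finType) (k : nat).

(** Recording the part of each element, [None] for the uncovered ones, makes the parts disjoint by
    construction. *)
Definition assignment := {ffun V -> option 'I_k}.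
Implicit Types (f : assignment) (i : 'I_k) (A : {set V}).

Definition part f i : {set V} := [set v | f v == Some i].
Definition covered f : {set V} := [set v | f v != None].
Definition assign f x o : assignment := [ffun v => if v == x then o else f v].

Variable M : 'I_k -> matroid V.

Definition feasible f := forall i, part f i \in indep (M i).

Lemma part_sub_covered f i : part f i \subset covered f.
Proof. by apply/subsetP => v; rewrite !inE => /eqP ->. Qed.

Lemma part_inj f i j x : x \in part f i -> x \in part f j -> i = j.
Proof. by rewrite !inE => /eqP -> /eqP []. Qed.

Lemma partitionable_covered f : feasible f -> partitionable M (covered f).
Proof.
move=> ff; apply/existsP; exists [ffun i => part f i]; apply/and3P; split.
- apply/eqP/setP => v; apply/bigcupP/idP => [[i _]|].
    by rewrite ffunE => /(subsetP (part_sub_covered f i)).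
  by rewrite inE; case E: (f v) => [i|] // _; exists i => //; rewrite ffunE inE E.
- apply/forallP => i; apply/forallP => j; apply/implyP => neq_ij.
  rewrite !ffunE -setI_eq0; apply/eqP/setP => x; rewrite in_set0 in_setI.
  by apply: contraNF neq_ij => /andP[/part_inj xi /xi ->].
by apply/forallP => i; rewrite ffunE.
Qed.

Lemma card_covered_max f : feasible f -> #|covered f| <= max_partitionable M.
Proof.
move=> ff; rewrite /max_partitionable.
by rewrite (leq_bigmax_cond (F := fun S : {set V} => #|S|)) // partitionable_covered.
Qed.

(** Weak duality: a partitionable set has at most [#|~: A|] elements outside [A], and its i-th part
    meets [A] in an independent set spanned by [K i], hence no larger than [K i]. *)
Lemma max_partitionable_leq A (K : 'I_k -> {set V}) :
  (forall i, K i \in indep (M i)) ->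
  (forall i, {in A, forall u, spanned (M i) (K i) u}) ->
  max_partitionable M <= #|~: A| + \sum_i #|K i|.
Proof.
move=> iK sp; apply/bigmax_leqP => S /existsP[P /and3P[/eqP defS _ /forallP iP]].
rewrite -(cardsID A S) addnC leq_add //.
  by rewrite subset_leq_card // setDE subsetIr.
apply: (@leq_trans (\sum_i #|P i :&: A|)).
  apply: leq_trans (card_bigcup_leq _); rewrite subset_leq_card //.
  apply/subsetP => x; rewrite inE -defS => /andP[/bigcupP[i _ xi] xA].
  by apply/bigcupP; exists i => //; rewrite inE xi.
apply: leq_sum => i _; apply: leq_card_spanned (iK i) _ _.
  by apply: indep_sub (iP i) _; apply: subsetIl.
by move=> x /setIP[_ /sp].
Qed.

End Assignments.

(** * Searching for augmenting paths and following them *)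

Section AugmentingPath.

Variables (V : finType) (k : nat).
Implicit Types (f : assignment V k) (i : 'I_k) (vis : seq (V * 'I_k)).

Definition seen vis : {set V} := [set x in map fst vis].

Definition exposed f vis := if vis is (x, _) :: _ then f x == None else false.

(* [todo] lists pairs (i, K), K being the part i or the part i minus a seen
   element. *)
Definition explore_step f (st : seq (V * 'I_k) * seq ('I_k * {set V})) :
    prog V k (option (seq (V * 'I_k) * seq ('I_k * {set V}))) :=
  let: (vis, todo) := st in
  if exposed f vis then Ret None else
  if todo is (i, K) :: todo' then
    bind (search i K (~: seen vis)) (fun o => Ret (Some (
      if o is Some x then
        ((x, i) :: vis,
         if f x is Some i' then (i', part f i' :\ x) :: todo else todo)
      else (vis, todo'))))
  else Ret None.

(** Initial potential of the search: one query retires each of the [k] initial pairs, and each seen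
    element pays for its own successful search and for retiring the pair it may add. *)
Definition explore_cost := k + depth V * #|V| + 3 * #|V|.

Definition explore f : prog V k (seq (V * 'I_k) * seq ('I_k * {set V})) :=
  loop explore_cost.+1 (explore_step f)
    ([::], [seq (i, part f i) | i <- enum 'I_k]).

(** [vis] runs from the latest seen element to the earliest, and [x] fits into part [i] once all of
    [vis] is removed. The elements are put back one by one; the first [y] that breaks independence
    is replaced by [x] and moves on to [iy], the part through which it was seen. *)
Fixpoint augment f x i vis : prog V k (assignment V k) :=
  if vis is (y, iy) :: vis' then
    let Y := x |: (part f i :\: seen vis') in
    Ask i Y (fun r =>
      if r == #|Y| then augment f x i vis'
      else augment (assign (assign f x (Some i)) y None) y iy vis')
  else Ret (assign f x (Some i)).

Definition augment_step f : prog V k (option (assignment V k)) :=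
  bind (explore f) (fun st =>
    if st.1 is (x, i) :: vis then
      if f x == None then bind (augment f x i vis) (fun f' => Ret (Some f'))
      else Ret None
    else Ret None).

Variable M : 'I_k -> matroid V.

(** Only the order of discovery is kept: no distances or predecessors are recorded, and [augment]
    recovers the exchanges from this order. *)
Fixpoint chain f vis : Prop :=
  if vis is (x, i) :: vis' then
    [/\ x \notin part f i, x \notin seen vis',
        x |: (part f i :\: seen vis') \in indep (M i) & chain f vis']
  else True.

Lemma seen_cons x i vis : seen ((x, i) :: vis) = x |: seen vis.
Proof. by apply/setP => z; rewrite !inE. Qed.

Lemma seen_nil : seen [::] = set0.
Proof. by apply/setP => z; rewrite !inE. Qed.

Lemma size_chain f vis : chain f vis -> size vis = #|seen vis|.
Proof.
elim: vis => [_|[x i] vis IH [_ nx _ /IH e]]; first by rewrite seen_nil cards0.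
by rewrite seen_cons cardsU1 nx -e.
Qed.

(* The exchange changes no other part, and by [spanned_exchange] it does not
   enlarge the span of [part f i :\: seen vis]. *)
Lemma chain_exchange f x y i vis :
  part f i \in indep (M i) -> f x = None -> f y = Some i ->
  x |: (part f i :\ y) \in indep (M i) ->
  x |: (part f i :\: seen vis) \notin indep (M i) ->
  x \notin seen vis -> y \notin seen vis -> chain f vis ->
  chain (assign (assign f x (Some i)) y None) vis.
Proof.
move=> iI fx fy i1; set f' := assign _ y None.
have neq_xy : x != y by apply/eqP => e; rewrite -e fx in fy.
have pi : part f' i = x |: (part f i :\ y).
  apply/setP => z; rewrite !inE !ffunE; have [->|_] := eqVneq z y.
    by rewrite (eq_sym y x) (negbTE neq_xy).
  by case: (z == x); rewrite ?eqxx.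
have pj j : j != i -> part f' j = part f j.
  move=> neq_ji; apply/setP => z; rewrite !inE !ffunE.
  have [->|_] := eqVneq z y; last have [->|//] := eqVneq z x.
    by rewrite fy; apply/esym/negbTE; rewrite eq_sym; apply: contra neq_ji => /eqP [->].
  by rewrite fx; apply/negbTE; rewrite eq_sym; apply: contra neq_ji => /eqP [->].
have xI : x \notin part f i by rewrite inE fx.
have yI : y \in part f i by rewrite inE fy.
elim: vis => [//|[z j] vis IH] i2.
rewrite seen_cons !in_setU1 !negb_or => /andP[neq_xz xv] /andP[neq_yz yv] /= [zj zv iz cv].
have i2' : x |: (part f i :\: seen vis) \notin indep (M i).
  apply: contra i2 => i2; apply: indep_sub i2 _; apply: setUS.
  by rewrite seen_cons setDS // subsetUr.
have cv' : chain f' vis by apply: IH.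
have [eji|neq_ji] := eqVneq j i; last by split=> //; rewrite pj.
rewrite eji in zj iz *; split=> //.
  by rewrite pi in_setU1 in_setD1 negb_or eq_sym neq_xz (negbTE zj) andbF.
have : ~~ spanned (M i) (part f i :\: seen vis) z.
  by rewrite /spanned iz orbF inE (negbTE zj) andbF.
move/(contra (spanned_exchange iI xI yI xv yv i1 i2')).
by rewrite -pi => /not_spanned[].
Qed.

Lemma augmentP f x i vis :
  feasible M f -> f x = None -> chain f ((x, i) :: vis) ->
  [/\ feasible M (value M (augment f x i vis)),
      #|covered (value M (augment f x i vis))| = #|covered f|.+1
    & cost M (augment f x i vis) = size vis].
Proof.
elim: vis f x i => [|[y iy] vis IH] f x i ff fx.
  case=> [_ _ ix _] /=.
  have e j : part (assign f x (Some i)) j = if j == i then x |: part f i else part f j.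
    apply/setP => z; rewrite [LHS]inE ffunE.
    case: (eqVneq j i) => [->|neq_ji]; rewrite !inE; first by case: (z == x); rewrite ?eqxx.
    have [->|//] := eqVneq z x; rewrite fx; apply/negbTE.
    by apply: contra neq_ji => /eqP[->].
  rewrite seen_nil setD0 in ix.
  split=> //.
    by move=> j; rewrite e; case: eqP => [->|].
  suff -> : covered (assign f x (Some i)) = x |: covered f.
    by rewrite cardsU1 inE fx.
  by apply/setP => z; rewrite !inE ffunE; case: (z == x).
case=> [xi xv ix cv] /=; rewrite rank_eq_card; case: ifPn => ix'.
  have [|f1 f2 ->] := IH f x i ff fx; last by split.
  by split=> //; [move: xv; rewrite seen_cons in_setU1 negb_or => /andP[]| case: cv].
move: xv; rewrite seen_cons in_setU1 negb_or => /andP[neq_xy xv].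
case: cv => [yiy yv iy1 cv].
(* Otherwise putting [y] back would change nothing in part [i], and the test would have
   succeeded. *)
have yI : y \in part f i.
  apply: contraNT ix' => yI; move: ix; rewrite seen_cons.
  suff -> : part f i :\: (y |: seen vis) = part f i :\: seen vis by [].
  apply/setP => z; rewrite !in_setD in_setU1.
  by have [->|//] := eqVneq z y; rewrite (negbTE yI) !andbF.
have fy : f y = Some i by move: yI; rewrite inE => /eqP.
have i1 : x |: (part f i :\ y) \in indep (M i).
  apply: (@indep_exchange _ _ _ (seen vis)) => //.
  by rewrite -(seen_cons y iy).
have cv' := chain_exchange (ff i) fx fy i1 ix' xv yv cv.
set f' := assign _ y None in cv' *.
have pj j : part f' j = if j == i then x |: (part f i :\ y) else part f j.
  apply/setP => z; rewrite [LHS]inE !ffunE.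
  case: (eqVneq j i) => [->|neq_ji]; rewrite !inE.
    have [->|_] := eqVneq z y; first by rewrite (eq_sym y x) (negbTE neq_xy).
    by case: (z == x); rewrite ?eqxx.
  have [->|_] := eqVneq z y; last have [->|//] := eqVneq z x.
    by rewrite fy; apply/esym/negbTE; rewrite eq_sym; apply: contra neq_ji => /eqP [->].
  by rewrite fx; apply/negbTE; rewrite eq_sym; apply: contra neq_ji => /eqP [->].
have ff' : feasible M f' by move=> j; rewrite pj; case: eqP => [->|].
have f'y : f' y = None by rewrite ffunE eqxx.
(* [y] lies in part [i] but not in part [iy], so the exchange leaves the part that [y] moves to
   untouched. *)
have neq_iyi : iy != i by apply: contraNneq yiy => ->.
have [|f1 -> ->] := IH f' y iy ff' f'y.
  split=> //; first by rewrite inE f'y.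
  by rewrite pj (negbTE neq_iyi).
split=> //; congr _.+1.
have /(congr1 (fun X : {set V} => #|X|)) : x |: covered f = y |: covered f'.
  apply/setP => z; rewrite !inE !ffunE; have [->|_] := eqVneq z y.
    by rewrite fy orbT.
  by case: (z == x).
rewrite !cardsU1 !inE fx f'y /=; lia.
Qed.

(** Each part, whole or less one of its seen elements, is still pending or spans all unseen
    elements. When nothing is pending, [spanned_setD] yields spanning by the part less all seen
    elements. *)
Definition explore_inv f (st : seq (V * 'I_k) * seq ('I_k * {set V})) : Prop :=
  let: (vis, todo) := st in
  chain f vis /\
  (exposed f vis \/
   [/\ forall x, x \in seen vis -> f x != None,
       forall p, p \in todo -> p.2 \subset part f p.1 /\
                   part f p.1 :\: seen vis \subset p.2,
       forall i, (i, part f i) \in todo \/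
                 {in ~: seen vis, forall u, spanned (M i) (part f i) u}
     & forall v i, v \in seen vis -> f v = Some i ->
         (i, part f i :\ v) \in todo \/
         {in ~: seen vis, forall u, spanned (M i) (part f i :\ v) u}]).

Lemma exploreP f : feasible M f ->
  cost M (explore f) <= explore_cost /\
  (let vis := (value M (explore f)).1 in chain f vis /\
  (exposed f vis \/ max_partitionable M = #|covered f|)).
Proof.
move=> ff; rewrite and_comm /explore.
pose mu (st : seq (V * 'I_k) * seq ('I_k * {set V})) :=
  size st.2 + (depth V + 3) * (#|V| - #|seen st.1|).
pose Q (st : seq (V * 'I_k) * seq ('I_k * {set V})) := 
  chain f st.1 /\ (exposed f st.1 \/ max_partitionable M = #|covered f|).
have mu0 : mu ([::], [seq (i, part f i) | i <- enum 'I_k]) = explore_cost.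
  by rewrite /mu /explore_cost size_map size_enum_ord /= seen_nil cards0; lia.
rewrite -mu0; apply: (@loopP _ _ _ _ _ (explore_inv f) Q) => //; last first.
  split=> //; right; split=> [x|p /mapP[i _ ->]|i|v i]; rewrite ?seen_nil ?inE //=.
    by rewrite setD0.
  by left; apply/mapP; exists i; rewrite ?mem_enum.
case=> vis todo [cv]; rewrite /explore_step.
case: ifPn => [ex _|nex]; first by split=> //; split=> //; left.
case=> // -[cov Ksub sp1 sp2]; case: todo Ksub sp1 sp2 => [|[i K] todo] Ksub sp1 sp2.
  (* Nothing is pending: duality for the set of unseen elements is tight, because all seen elements
     are covered. *)
  split=> //; split=> //; right; apply/eqP; rewrite eqn_leq card_covered_max // andbT.
  have := @max_partitionable_leq _ _ M (~: seen vis) (fun i => part f i :\: seen vis).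
  rewrite setCK => /(_ _ _)/leq_trans; apply.
  - by move=> i; apply: indep_sub (ff i) _; apply: subsetDl.
  - move=> i u us; apply: spanned_setD => //; last by rewrite inE in us.
      by case: (sp1 i) => // /(_ u us).
    move=> v /setIP[]; rewrite inE => /eqP fv vs.
    by case: (sp2 v i vs fv) => // /(_ u us).
  apply: (@leq_trans (#|seen vis| + #|covered f :\: seen vis|)).
    rewrite leq_add2l; apply: sum_card_leq => [i|i j x].
      by apply: setSD; apply: part_sub_covered.
    by move=> /setDP[/part_inj xi _] /setDP[/xi].
  rewrite -(cardsID (seen vis) (covered f)) leq_add2r subset_leq_card //.
  by apply/subsetP => x xs; rewrite in_setI xs inE cov.
have [Ks sK] := Ksub (i, K) (mem_head _ _).
have iK : K \in indep (M i) by apply: indep_sub (ff i) Ks.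
have := searchP (~: seen vis) iK; move: (search i K _) => s.
rewrite value_bind cost_bind /= addn0.
case: (value M s) => [x [xs /not_spanned[xK ix] ->]|[sp ->]]; last first.
  split; [|by rewrite /mu /=; lia|by rewrite /mu /=; lia].
  split=> //; right; split=> //.
  - by move=> p pt; apply: Ksub; rewrite inE pt orbT.
  - move=> j; case: (sp1 j) => [|]; last by right.
    by rewrite inE => /orP[/eqP[-> ->]|]; [right|left].
  - move=> v j vs fv; case: (sp2 v j vs fv) => [|]; last by right.
    by rewrite inE => /orP[/eqP[-> ->]|]; [right|left].
rewrite inE in xs.
have xi : x \notin part f i.
  by apply: contra xK => xi; apply: (subsetP sK); rewrite inE xs.
have cx : #|seen ((x, i) :: vis)| = #|seen vis|.+1 by rewrite seen_cons cardsU1 xs.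
have ltV : #|seen vis| < #|V| by rewrite -cx max_card.
have muP (t : seq ('I_k * {set V})) : size t <= (size todo).+2 ->
  mu ((x, i) :: vis, t) < mu (vis, (i, K) :: todo) /\
  mu ((x, i) :: vis, t) + (depth V).+1 <= mu (vis, (i, K) :: todo).
  rewrite /mu cx -(subnSK ltV) mulnS /=.
  move: (depth V) (_ * _) => a b; lia.
have cv' : chain f ((x, i) :: vis).
  by split=> //; apply: indep_sub ix _; apply: setUS.
case fx: (f x) => [i'|]; last first.
  have [m1 m2] := muP ((i, K) :: todo) (leqnSn _).
  by split=> //; split=> //; left; rewrite /exposed fx.
have [m1 m2] := muP [:: (i', part f i' :\ x), (i, K) & todo] (leqnn _).
split=> //; split=> //; right; rewrite seen_cons; split.
- by move=> y /setU1P[->|/cov //]; rewrite fx.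
- move=> p; rewrite inE => /orP[/eqP ->|/Ksub[p1 p2]] /=.
    split; first exact: subsetDl.
    by apply: setDS; apply: subsetUl.
  by split=> //; apply: subset_trans p2; apply: setDS; apply: subsetUr.
- move=> j; case: (sp1 j) => [jt|sp]; first by left; rewrite inE jt orbT.
  by right=> u us; apply: sp; apply: subsetP us; rewrite setCS subsetUr.
- move=> v j /setU1P[->|vs] fv.
    by left; move: fv; rewrite fx => -[->]; apply: mem_head.
  case: (sp2 v j vs fv) => [jt|sp]; first by left; rewrite inE jt orbT.
  by right=> u us; apply: sp; apply: subsetP us; rewrite setCS subsetUr.
Qed.

Lemma augment_stepP f : feasible M f ->
  if value M (augment_step f) is Some f' then
    [/\ feasible M f', #|covered f'| = #|covered f|.+1
      & cost M (augment_step f) <= explore_cost + #|V|]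
  else max_partitionable M = #|covered f| /\
       cost M (augment_step f) <= explore_cost + #|V|.
Proof.
move=> ff; have [le [cv ex]] := exploreP ff.
rewrite /augment_step value_bind cost_bind.
case: (value M (explore f)) cv ex => /= [[|[x i] vis] todo] /= cv ex.
  by case: ex => // e; split=> //; lia.
case: eqP ex => [fx _|_ [//|e]] /=; last by split=> //; lia.
rewrite value_bind cost_bind /= addn0.
have [f1 f2 ->] := augmentP ff fx cv; split=> //.
apply: leq_add le _; apply: ltnW.
have cvx : chain f ((x, i) :: vis) := cv.
by rewrite (leq_trans _ (max_card (seen ((x, i) :: vis)))) // -(size_chain cvx).
Qed.

Definition round_cost := (explore_cost + #|V|).+1.

Definition augment_all f : prog V k (assignment V k) :=
  loop ((#|V|).+1 * round_cost).+1 augment_step f.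

(** At most [d] rounds gain an element, and one more finds no path, which certifies maximality. *)
Lemma augment_allP f d : feasible M f -> max_partitionable M <= #|covered f| + d ->
  [/\ feasible M (value M (augment_all f)),
      #|covered (value M (augment_all f))| = max_partitionable M
    & cost M (augment_all f) <= d.+1 * round_cost].
Proof.
move=> ff led.
pose mu f := (max_partitionable M - #|covered f|).+1 * round_cost.
pose Q f := feasible M f /\ #|covered f| = max_partitionable M.
have [||[q1 q2] c] := @loopP _ _ M _ augment_step (feasible M) Q mu
  ((#|V|).+1 * round_cost).+1 f _ ff.
- move=> g fg; have := augment_stepP fg.
  case: (value M _) => [g' [fg' cg' le]|[e le]].
    have := card_covered_max fg'; rewrite cg' => lt.
    have -> : mu g = mu g' + round_cost by rewrite /mu cg' -(subnSK lt) mulSn addnC.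
    by split=> //; rewrite ?leq_add2l /round_cost; lia.
  by split=> //; rewrite /mu e subnn mul1n /round_cost; lia.
- rewrite ltnS leq_mul2r; apply/orP; right; rewrite ltnS.
  rewrite (leq_trans (leq_subr _ _)) //; apply/bigmax_leqP => S _; exact: max_card.
split=> //; apply: leq_trans c _; rewrite leq_mul2r; apply/orP; right; lia.
Qed.

End AugmentingPath.

(** * Levels and free places *)


Definition relevel (T : eqType) (l : T -> nat) (w : T) (j : nat) : T -> nat :=
  fun v => if v == w then j else l v.

Definition lower (V : finType) (J : {set V}) (l : V -> nat) (t : nat) : {set V} :=
  [set v in J | l v <= t].

Section Levels.

Variables (V : finType) (M : matroid V).
Implicit Types (I J : {set V}) (l lam : V -> nat) (g w u v : V) (t j T : nat).

(* The elements of J carry their own levels [lam]: they agree with [l], except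
   that J may contain a ghost, an element that has just left the part. *)
Definition valid l lam J T : Prop :=
  J \in indep M /\
  forall t u, t <= T -> l u < t -> spanned M (lower J lam t) u.

Lemma lower_sub J l t : lower J l t \subset J.
Proof. by apply/subsetP => v; rewrite inE => /andP[]. Qed.

Lemma lower_ghost I l g j t : g \notin I ->
  lower (g |: I) (relevel l g j) t = if j <= t then g |: lower I l t else lower I l t.
Proof.
move=> gI; apply/setP => v; rewrite /relevel inE in_setU1.
have [->|neq_vg] := eqVneq v g; case: ifP => _; rewrite ?in_setU1 ?eqxx //.
  by rewrite inE (negbTE gI).
all: by rewrite ?(negbTE neq_vg) /= [RHS]inE.
Qed.

Lemma valid_sub l l' lam lam' J T :
  (forall v, l v <= l' v) -> {in J, lam =1 lam'} ->
  valid l lam J T -> valid l' lam' J T.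
Proof.
move=> le e [iJ sp]; split=> // t u tT lt.
suff <- : lower J lam t = lower J lam' t.
  by apply: sp tT _; apply: leq_ltn_trans lt.
by apply/setP => v; rewrite !inE; case: (boolP (v \in J)) => // /e ->.
Qed.

(** Only the condition at [t = j] loses the ghost, and there [lower I l j] alone spans what is
    required. *)
Lemma valid_raise_ghost I l g j T : g \notin I ->
  {in [set u | l u < j], forall u, spanned M (lower I l j) u} ->
  valid l (relevel l g j) (g |: I) T -> valid l (relevel l g j.+1) (g |: I) T.
Proof.
move=> gI spj [iJ sp]; split=> // t u tT lt; have := sp t u tT lt.
rewrite !lower_ghost //; case: (ltngtP j t) => // ejt _.
by rewrite -ejt; apply: spj; rewrite inE ejt.
Qed.

Lemma valid_drop_ghost I l g j T : g \notin I -> T < j ->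
  valid l (relevel l g j) (g |: I) T -> valid l l I T.
Proof.
move=> gI Tj [iJ sp]; split=> [|t u tT lt].
  by apply: indep_sub iJ _; apply: subsetUr.
by have := sp t u tT lt; rewrite lower_ghost // leqNgt (leq_ltn_trans tT Tj).
Qed.

Lemma leq_relevel l w j v : l w <= j -> l v <= relevel l w j v.
Proof. by rewrite /relevel; case: eqP => [->|]. Qed.

(** For [t >= j] the set [g |: lower I l t] spans [w], so replacing [g] by [w] gives an independent
    set of the same size and span. Below [j] neither of them occurs. *)
Lemma valid_fill_ghost I l g w j T : g \notin I -> j <= T -> l w < j ->
  ~~ spanned M (lower I l j) w ->
  valid l (relevel l g j) (g |: I) T ->
  valid (relevel l w j) (relevel l w j) (w |: I) T.
Proof.
move=> gI jT wj nsp [iJ sp].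
have wI : w \notin I.
  by have [+ _] := not_spanned nsp; rewrite inE (ltnW wj) andbT.
have spw t : j <= t -> t <= T -> spanned M (g |: lower I l t) w.
  by move=> jt tT; have := sp t w tT (leq_trans wj jt); rewrite lower_ghost // jt.
have iwI : w |: I \in indep M.
  by apply: indep_swap (lower_sub I l j) iJ gI wI nsp (spw j _ _).
split=> // t u tT lt; have lut := leq_ltn_trans (leq_relevel u (ltnW wj)) lt.
have := sp t u tT lut; rewrite !lower_ghost //; case: ifP => // jt.
have cg : #|g |: lower I l t| = #|w |: lower I l t|.
  by rewrite !cardsU1 !inE (negbTE gI) (negbTE wI).
apply: spanned_trans; rewrite ?cg //.
- by apply: indep_sub iJ _; apply/setUS/lower_sub.
- by apply: indep_sub iwI _; apply/setUS/lower_sub.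
move=> x /setU1P[->|xI]; last by rewrite /spanned setU1r.
exact: spw.
Qed.

(** As no element of [I] exceeds level [T.+1], [w] fits into the whole of [I]; its new level lies
    beyond every threshold up to [T]. *)
Lemma valid_fill I l w T : l w < T.+1 -> {in I, forall v, l v <= T.+1} ->
  ~~ spanned M (lower I l T.+1) w -> valid l l I T ->
  valid (relevel l w T.+1) (relevel l w T.+1) (w |: I) T.
Proof.
move=> wT leI; have -> : lower I l T.+1 = I.
  by apply/setP => v; rewrite !inE; case: (boolP (v \in I)) => // /leI.
move=> /not_spanned[wI iwI] [iI sp]; split=> // t u tT lt.
rewrite lower_ghost // [T < t]ltnNge tT /=.
by apply: sp tT _; apply: leq_ltn_trans lt; apply: leq_relevel; apply: ltnW.
Qed.

Lemma valid_advance I l T : valid l l I T ->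
  {in [set u | l u < T.+1], forall u, spanned M (lower I l T.+1) u} ->
  valid l l I T.+1.
Proof.
move=> [iI sp] spT; split=> // t u; rewrite leq_eqVlt => /orP[/eqP->|].
  by move=> lt; apply: spT; rewrite inE.
by rewrite ltnS; apply: sp.
Qed.

End Levels.

(** * The phases: pushing elements into free places *)

Section PushRelabel.

Variables (V : finType) (k : nat).

(** [hole] is the free place being served, given by its part and level; the ghost occupying it
    exists only in the invariant. *)
Record state := State {
  asg : assignment V k;
  lev : V -> nat;
  phase : nat;
  next : nat;
  hole : option ('I_k * nat)
}.

Implicit Types (st : state) (i : 'I_k) (w : V) (j : nat).

(* The matroids before [next] are already done with the current phase. *)
Definition done_level st i := if i < next st then phase st else (phase st).-1.

(** A place vacated above the done level of its part is dropped, since no condition up to that level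
    depends on it. *)
Definition push st w i j :=
  State (assign (asg st) w (Some i)) (relevel (lev st) w j) (phase st) (next st)
    (if asg st w is Some i' then
       if lev st w <= done_level st i' then Some (i', lev st w) else None
     else None).

Definition set_hole st h := State (asg st) (lev st) (phase st) (next st) h.

Definition search_at st i j :=
  search i (lower (part (asg st) i) (lev st) j) [set u | lev st u < j].

Definition push_step st : prog V k (option state) :=
  if hole st is Some (i, j) then
    bind (search_at st i j) (fun o => Ret (Some (
      if o is Some w then push st w i j
      else set_hole st (if j < done_level st i then Some (i, j.+1) else None))))
  else if (insub (next st) : option 'I_k) is Some i then
    bind (search_at st i (phase st)) (fun o => Ret (Some (
      if o is Some w then push st w i (phase st)
      else State (asg st) (lev st) (phase st) (next st).+1 None)))
  else if #|covered (asg st)| <= phase st * phase st then Ret None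
  else Ret (Some (State (asg st) (lev st) (phase st).+1 0 None)).

Variable M : 'I_k -> matroid V.

Definition valid_at st i : Prop :=
  if hole st is Some (i0, j) then
    if i0 == i then
      exists g, [/\ g \notin part (asg st) i, j <= done_level st i
        & valid (M i) (lev st) (relevel (lev st) g j) (g |: part (asg st) i)
            (done_level st i)]
    else valid (M i) (lev st) (lev st) (part (asg st) i) (done_level st i)
  else valid (M i) (lev st) (lev st) (part (asg st) i) (done_level st i).

(** [D] belongs to the analysis, where its square is at least the maximum; the algorithm does not
    know the maximum. *)
Definition push_inv D st : Prop :=
  [/\ 0 < phase st <= D, next st <= k,
      forall v, asg st v = None -> lev st v = 0,
      forall v, lev st v <= phase st
    & forall i, valid_at st i].

Lemma part_assign (f : assignment V k) w i i' :
  part (assign f w (Some i)) i' =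
    if i' == i then w |: part f i else part f i' :\ w.
Proof.
apply/setP => v; rewrite [LHS]inE ffunE.
have [->|neq] := eqVneq i' i; rewrite !inE; case: (v == w); rewrite ?eqxx //=.
by apply/negbTE; apply: contra neq => /eqP[->].
Qed.

(** The part entered is valid by assumption, the part left keeps [w] as a ghost at its old level,
    and the others only see [w] rise. *)
Lemma push_invP D st w i j :
  push_inv D st -> (if hole st is Some (i0, _) then i0 = i else True) ->
  lev st w < j <= phase st -> w \notin part (asg st) i ->
  valid (M i) (relevel (lev st) w j) (relevel (lev st) w j)
    (w |: part (asg st) i) (done_level st i) ->
  push_inv D (push st w i j).
Proof.
move=> [phD nk lev0 levp va] hi /andP[wj jp] wi vi; split=> //=.
- move=> v; rewrite ffunE /relevel; case: eqP => // _; exact: lev0.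
- by move=> v; rewrite /relevel; case: eqP.
move=> i'; rewrite /valid_at /=.
have dl x : done_level (push st w i j) x = done_level st x by [].
set h := (X in if X is Some _ then _ else _).
have [eii'|neq_i'] := eqVneq i' i.
  rewrite eii' part_assign eqxx dl.
  suff : if h is Some (i0, _) then i0 != i else true by case: h => [[i0 s] /negbTE ->|].
  rewrite /h; case fw: (asg st w) => [i0|] //; case: ifP => // _.
  by apply: contra wi => /eqP <-; rewrite inE fw.
have vi' : valid (M i') (lev st) (lev st) (part (asg st) i') (done_level st i').
  move: hi (va i'); rewrite /valid_at; case: (hole st) => // -[i0 s] ->.
  by rewrite eq_sym (negbTE neq_i').
have le v : lev st v <= relevel (lev st) w j v by apply: leq_relevel; apply: ltnW.
rewrite part_assign (negbTE neq_i') dl.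
have [wi'|wi'] := boolP (w \in part (asg st) i').
  have fw : asg st w = Some i' by move: wi'; rewrite inE => /eqP.
  have gv : valid (M i') (relevel (lev st) w j)
     (relevel (relevel (lev st) w j) w (lev st w)) (w |: (part (asg st) i' :\ w))
     (done_level st i').
    rewrite setD1K //; apply: valid_sub le _ vi' => v _ /=.
    by rewrite /relevel; case: eqP => [->|].
  rewrite /h fw; case: leqP => lt; first by rewrite eqxx; exists w; rewrite !inE eqxx.
  by apply: valid_drop_ghost lt gv; rewrite !inE eqxx.
suff : if h is Some (i0, _) then i0 != i' else true.
  have -> : part (asg st) i' :\ w = part (asg st) i'.
    by apply/setDidPl; rewrite disjoint_sym disjoints1.
  have : valid (M i') (relevel (lev st) w j) (relevel (lev st) w j)
            (part (asg st) i') (done_level st i').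
    apply: valid_sub le _ vi' => v vi1; rewrite /relevel; case: eqP => // e.
    by rewrite -e vi1 in wi'.
  by case: h => [[i0 s] v /negbTE ->|].
rewrite /h; case fw: (asg st w) => [i0|] //; case: ifP => // _.
by apply: contra wi' => /eqP <-; rewrite inE fw.
Qed.

Definition gap_sum D (l : V -> nat) := \sum_v (D - l v).

(** Lag is charged to places rather than elements: an element that fills a hole just exchanges the
    lags of the two places. *)
Definition lag_sum (f : assignment V k) (l : V -> nat) m :=
  \sum_v (f v != None) * (m - l v).

Definition hole_lag st := if hole st is Some (_, j) then (phase st).+1 - j else 0.

(** [gap_sum] pays for the pushes, the lags for raising holes, the terms in [k] for one failing
    search per matroid and phase, and the last term for the lag that a new phase adds. *)
Definition potential D st :=
  (depth V + 3) * gap_sum D (lev st) + lag_sum (asg st) (lev st) (phase st)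
  + hole_lag st
  + k * (D - phase st) + (k - next st) + (#|V|).+1 * (D - phase st).

Lemma gap_sum_relevel D (l : V -> nat) w j : l w < j <= D ->
  gap_sum D (relevel l w j) + (j - l w) = gap_sum D l.
Proof.
move=> /andP[lt le]; rewrite /gap_sum (bigD1 w) //= [RHS](bigD1 w) //=.
have -> : \sum_(v | v != w) (D - relevel l w j v) = \sum_(v | v != w) (D - l v).
  by apply: eq_bigr => v /negbTE neq; rewrite /relevel neq.
rewrite {1}/relevel eqxx; lia.
Qed.

Lemma lag_sum_relevel (f : assignment V k) (l : V -> nat) m w i j :
  lag_sum (assign f w (Some i)) (relevel l w j) m + (f w != None) * (m - l w)
  = lag_sum f l m + (m - j).
Proof.
rewrite /lag_sum (bigD1 w) //= [in RHS](bigD1 w) //=.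
have -> : \sum_(v | v != w) (assign f w (Some i) v != None) * (m - relevel l w j v)
        = \sum_(v | v != w) (f v != None) * (m - l v).
  by apply: eq_bigr => v /negbTE neq; rewrite /relevel ffunE neq.
rewrite {1}/relevel ffunE eqxx mul1n addnAC [RHS]addnC -addnA; congr (_ + _); exact: addnC.
Qed.

Lemma potential_push D st w i j :
  lev st w < j <= phase st -> phase st <= D ->
  (if hole st is Some (_, j0) then j0 = j else j = phase st) ->
  potential D (push st w i j) + (depth V).+1 < potential D st.
Proof.
move=> /andP[wj jm] mD hj; have := @gap_sum_relevel D (lev st) w j.
rewrite wj (leq_trans jm mD) => /(_ isT) eg.
have := lag_sum_relevel (asg st) (lev st) (phase st) w i j.
have -> : potential D (push st w i j) =
    (depth V + 3) * gap_sum D (relevel (lev st) w j)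
    + lag_sum (assign (asg st) w (Some i)) (relevel (lev st) w j) (phase st)
    + hole_lag (push st w i j)
    + k * (D - phase st) + (k - next st) + (#|V|).+1 * (D - phase st) by [].
rewrite /potential -eg mulnDr; move: (lag_sum _ _ _) (lag_sum _ _ _) => S S' es.
have lh : depth V + 3 <= (depth V + 3) * (j - lev st w).
  by rewrite leq_pmulr // subn_gt0.
(* Of the [depth V + 3] released by the rise of [w], [depth V + 1] pays for the search, one covers
   the growth allowed here, and one makes the drop strict. *)
suff le : S' + hole_lag (push st w i j) <= S + hole_lag st + 1.
  move: lh; set a := (_ * (j - _)); move: a => a.
  set b := _ * gap_sum _ _; set c := k * _; set d := _.+1 * (D - _).
  by clearbody b c d; lia.
have hh' : hole_lag (push st w i j)
             <= (asg st w != None) * ((phase st).+1 - lev st w).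
  by rewrite /hole_lag /=; case: (asg st w) => // i'; case: ifP => //=; lia.
have hh : (phase st).+1 - j <= hole_lag st + (hole st == None).
  by move: hj; rewrite /hole_lag; case: (hole st) => [[i0 j0]|] -> /=; rewrite ?subSnn ?addn0.
have hn : hole st == None -> j = phase st by move: hj; case: (hole st).
move: es hh'; move: (hole_lag (push _ _ _ _)) => h'.
move: hh hn; case: (hole st == None) => /= hh hn;
  case: (asg st w != None); rewrite ?mul1n ?mul0n; lia.
Qed.

Lemma push_end D st : push_inv D st -> hole st = None -> k <= next st ->
  #|covered (asg st)| <= phase st * phase st ->
  feasible M (asg st) /\
  max_partitionable M <= #|covered (asg st)| + D.
Proof.
move=> [/andP[m0 mD] nk lev0 levm va] h0 kn sm.
have {}va i : valid (M i) (lev st) (lev st) (part (asg st) i) (phase st).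
  by have := va i; rewrite /valid_at h0 /done_level (leq_trans (ltn_ord i) kn).
have ff : feasible M (asg st) by move=> i; case: (va i).
split=> //; set S := covered _ in sm *.
set m := phase st in m0 mD va sm *; set l := lev st in va lev0.
pose N t := [set v in S | l v == t].
have bnd (t : 'I_m) : max_partitionable M <= #|S| + #|N t.+1|.
  have := @max_partitionable_leq _ _ M [set u | l u < t.+1]
    (fun i => lower (part (asg st) i) l t.+1).
  move=> /(_ _ _)/leq_trans; apply.
  - by move=> i; apply: indep_sub (ff i) _; apply: lower_sub.
  - by move=> i u; rewrite inE => lt; case: (va i) => _; apply; rewrite // ltn_ord.
  apply: (@leq_trans (#|~: [set u | l u < t.+1]| + #|lower S l t.+1|)).
    rewrite leq_add2l; apply: sum_card_leq => [i|i i' x].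
      apply/subsetP => v; rewrite inE => /andP[/(subsetP (part_sub_covered _ _)) vS le].
      by rewrite inE vS.
    by rewrite !in_set => /andP[/eqP -> _] /andP[/eqP[->] _].
  (* Uncovered elements have level 0, so all elements of level at least [t.+1] are covered; they
     meet the lower part of [S] in level [t.+1] only. *)
  rewrite -cardsUI leq_add // subset_leq_card //; apply/subsetP => v; rewrite !inE.
    case/orP=> [|/andP[]//]; apply: contra => /eqP /lev0 ->; exact: ltn0Sn.
  by rewrite -leqNgt => /andP[le1 /andP[-> le2]]; rewrite eqn_leq le2 le1.
have : \sum_(t < m) max_partitionable M <= \sum_(t < m) (#|S| + #|N t.+1|).
  by apply: leq_sum => t _; apply: bnd.
rewrite big_split /= !sum_nat_const !card_ord.
have : \sum_(t < m) #|N t.+1| <= #|S|.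
  apply: sum_card_leq => [t|t t' x]; first by apply/subsetP => v; rewrite inE => /andP[].
  by rewrite !inE => /andP[_ /eqP ->] /andP[_ /eqP[/val_inj]].
move=> le1 le2; have : m * max_partitionable M <= m * (#|S| + m).
  rewrite mulnDr; apply: leq_trans le2 _; rewrite leq_add2l (leq_trans le1) //.
by rewrite leq_pmul2l // => /leq_trans; apply; rewrite leq_add2l.
Qed.

Lemma lag_sumS f l m : lag_sum f l m.+1 <= lag_sum f l m + #|V|.
Proof.
rewrite /lag_sum -sum1_card -big_split leq_sum //= => v _.
by case: (f v != None); rewrite /= ?mul1n ?mul0n //; lia.
Qed.

Lemma push_stepP D st : max_partitionable M <= D * D -> push_inv D st ->
  if value M (push_step st) is Some st' then
    [/\ push_inv D st', potential D st' < potential D st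
      & potential D st' + cost M (push_step st) <= potential D st]
  else (feasible M (asg st) /\ max_partitionable M <= #|covered (asg st)| + D) /\
       cost M (push_step st) <= potential D st.
Proof.
move=> leD inv; have [/andP[m0 mD] nk lev0 levm va] := inv.
rewrite /push_step; case hst: (hole st) => [[i j]|].
  have := va i; rewrite /valid_at hst eqxx => -[g [gi jd gv]].
  have dm : done_level st i <= phase st by rewrite /done_level; case: ifP; lia.
  have iK : lower (part (asg st) i) (lev st) j \in indep (M i).
    case: gv => iJ _; apply: indep_sub iJ _.
    exact: subset_trans (lower_sub _ _ _) (subsetUr _ _).
  have := searchP [set u | lev st u < j] iK; rewrite -/(search_at st i j).
  rewrite value_bind cost_bind; move: (search_at st i j) => s /=.
  rewrite addn0; case: (value M s) => [w [wj nsp ->]|[sp ->]].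
    rewrite inE in wj.
    have [wI _] := not_spanned nsp; rewrite inE (ltnW wj) andbT in wI.
    have wjm : lev st w < j <= phase st by rewrite wj (leq_trans jd dm).
    have pp : potential D (push st w i j) + (depth V).+1 < potential D st.
      by apply: potential_push; rewrite // hst.
    split; [|lia|lia].
    apply: push_invP => //; first by rewrite hst.
    exact: valid_fill_ghost gi jd wj nsp gv.
  have gv' := valid_raise_ghost gi sp gv.
  have vat i' : i' != i ->
    valid (M i') (lev st) (lev st) (part (asg st) i') (done_level st i').
    by move=> neq; have := va i'; rewrite /valid_at hst eq_sym (negbTE neq).
  set st' := set_hole st _.
  have lt : potential D st' < potential D st.
    rewrite /potential /hole_lag hst /=; case: ifP => jd'; rewrite ?ltn_add2r ?ltn_add2l; lia.
  split; [|lia|lia]; split=> //=; first by rewrite m0.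
  move=> i'.
  have [->|neq] := eqVneq i' i; last first.
    rewrite /valid_at /=; case: ifP => _; last exact: vat.
    by rewrite eq_sym (negbTE neq); apply: vat.
  rewrite /valid_at /=; case: ltnP => jd'; first by rewrite eqxx; exists g.
  by apply: valid_drop_ghost gv'.
have {}va i : valid (M i) (lev st) (lev st) (part (asg st) i) (done_level st i).
  by have := va i; rewrite /valid_at hst.
case: insubP => [i ltk vi|kn].
  have dl : done_level st i = (phase st).-1 by rewrite /done_level vi ltnn.
  have := va i; rewrite dl => vai; have [iI _] := vai.
  have iK : lower (part (asg st) i) (lev st) (phase st) \in indep (M i).
    by apply: indep_sub iI _; apply: lower_sub.
  have := searchP [set u | lev st u < phase st] iK; rewrite -/(search_at st i (phase st)).
  rewrite value_bind cost_bind; move: (search_at st i _) => s /=.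
  rewrite addn0; case: (value M s) => [w [wj nsp ->]|[sp ->]].
    rewrite inE in wj.
    have [wI _] := not_spanned nsp; rewrite inE (ltnW wj) andbT in wI.
    have wjm : lev st w < phase st <= phase st by rewrite wj /=.
    have pp : potential D (push st w i (phase st)) + (depth V).+1 < potential D st.
      by apply: potential_push; rewrite // hst.
    split; [|lia|lia].
    apply: push_invP => //; first by rewrite hst.
    (* The matroid [next] is still at done level [(phase st).-1], so [phase st] is the level just
       above its thresholds. *)
    rewrite dl -{1 2}(prednK m0); apply: valid_fill; rewrite ?prednK //.
  set st' := State _ _ _ _ _.
  have lt : potential D st' < potential D st.
    by rewrite /potential /hole_lag hst /= ltn_add2r ltn_add2l; lia.
  split; [|lia|lia]; split=> //=; first by rewrite m0.
  move=> i'.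
  rewrite /valid_at /= /done_level /= ltnS leq_eqVlt -vi.
  have [/val_inj ->|neq] := eqVneq (i' : nat) i; last by have := va i'; rewrite /done_level -vi.
  rewrite /= -(prednK m0); apply: valid_advance; rewrite ?prednK //.
rewrite -leqNgt in kn.
have ff : feasible M (asg st) by move=> i; case: (va i).
case: leqP => sm /=; first by split=> //; apply: push_end.
(* A new phase opens only if the square of the current one is below [#|covered (asg st)|], which is
   at most [D * D]. *)
have ltD : phase st < D.
  rewrite -ltn_sqr -!mulnn; apply: leq_trans sm _.
  by apply: leq_trans leD; apply: card_covered_max.
set st' := State _ _ _ _ _.
have lt : potential D st' < potential D st.
  have := lag_sumS (asg st) (lev st) (phase st).
  have kn0 : k - next st = 0 by lia.
  rewrite /potential /hole_lag hst /= kn0 ?subn0 -(subnSK ltD) !mulnS.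
  move: (k * _) (_.+1 * _) (_ * gap_sum _ _) (lag_sum _ _ _) (lag_sum _ _ _) => a b c d e.
  by lia.
rewrite addn0; split; [|exact: lt|exact: ltnW]; split=> //=.
- by move=> v; apply: leqW.
move=> i; rewrite /valid_at /= /done_level /=.
by have := va i; rewrite /done_level (leq_trans (ltn_ord i) kn).
Qed.

Definition init_state := State [ffun=> None] (fun=> 0) 1 0 None.

Definition push_cost D :=
  (depth V + 3) * (#|V| * D) + k * D + (#|V|).+1 * D.

(** The fuel is computed with [#|V| + 1] in place of [D], because it may not depend on the unknown
    maximum; the cost bound uses the smaller [D]. *)
Definition push_all : prog V k state :=
  loop (push_cost (#|V|).+1).+1 push_step init_state.

Lemma push_allP D : 0 < D <= (#|V|).+1 -> max_partitionable M <= D * D ->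
  [/\ feasible M (asg (value M push_all)),
      max_partitionable M <= #|covered (asg (value M push_all))| + D
    & cost M push_all <= push_cost D].
Proof.
move=> /andP[D0 DV] leD.
have pot0 : potential D init_state <= push_cost D.
  have -> : potential D init_state =
      (depth V + 3) * (#|V| * D) + k * (D - 1) + k + (#|V|).+1 * (D - 1).
    rewrite /potential /hole_lag /gap_sum /lag_sum /= subn0 addn0.
    rewrite [X in _ + X + _ + _ + _](_ : _ = 0) ?addn0.
      by rewrite sum_nat_const !subn0.
    by rewrite big1 // => v _; rewrite ffunE.
  rewrite /push_cost -!addnA leq_add2l addnA leq_add ?leq_mul ?leq_subr //.
  by rewrite -[in X in _ <= X](subnK D0) addn1 mulnS addnC.
have [|||[q1 q2] c] := @loopP _ _ M _ push_step (push_inv D)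
   (fun st => feasible M (asg st) /\ max_partitionable M <= #|covered (asg st)| + D)
   (potential D) (push_cost (#|V|).+1).+1 init_state.
- by move=> st; apply: push_stepP.
- split=> //= i; rewrite /valid_at /= /done_level /=.
  have -> : part ([ffun=> None] : assignment V k) i = set0.
    by apply/setP => v; rewrite !inE ffunE.
  by split; [apply: indep_set0|move=> t u; rewrite leqn0 => /eqP ->].
- rewrite ltnS (leq_trans pot0) // /push_cost.
  by rewrite !leq_add // leq_mul // leq_mul.
by split=> //; apply: leq_trans pot0.
Qed.

End PushRelabel.

(** * The algorithm *)


Section Algorithm.

Variables (V : finType) (k : nat).

Definition max_partition : prog V k {set V} :=
  bind (push_all V k) (fun st =>
  bind (augment_all (asg st)) (fun f => Ret (covered f))).

(** For [#|V| + k = 0] the bound to be met is 0, so the answer is given without a query. *)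
Definition max_partition_alg : rank_algorithm V k :=
  if #|V| + k == 0 then Return k set0 else compile max_partition.

Variable M : 'I_k -> matroid V.

Lemma max_partitionable_card : max_partitionable M <= #|V|.
Proof. by apply/bigmax_leqP => S _; apply: max_card. Qed.

(** Take the least positive [D] whose square reaches the maximum. If [D >= 2], the square of [D - 1]
    is below the maximum, and [D <= 2 * (D - 1)]. *)
Lemma ceil_sqrt : exists D,
  [/\ 0 < D <= (#|V|).+1, max_partitionable M <= D * D
    & D * D <= 4 * maxn (max_partitionable M) 1].
Proof.
have leV : max_partitionable M <= (#|V|).+1 * (#|V|).+1.
  by rewrite (leq_trans max_partitionable_card) // mulSn; lia.
have ex : exists D, (0 < D) && (max_partitionable M <= D * D) by exists (#|V|).+1.
case: (ex_minnP ex) => D /andP[D0 leD] minD; exists D; split=> //.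
  by rewrite D0 minD.
case: D D0 leD minD => [//|[|D]] _ leD minD; first by lia.
have : max_partitionable M > D.+1 * D.+1.
  rewrite ltnNge; apply/negP => le; have := minD D.+1; rewrite le ltnn => /(_ isT) //.
lia.
Qed.

(** The pushes cost at most [6 * (#|V| + k) * (depth V + 1)] per unit of [D], and so does each
    augmenting round; with [D + 1 <= 2 * D] rounds this gives 6 + 12 = 18. *)
Lemma max_partitionP D :
  0 < D <= (#|V|).+1 -> max_partitionable M <= D * D -> 0 < #|V| + k ->
  [/\ partitionable M (value M max_partition),
      #|value M max_partition| = max_partitionable M
    & cost M max_partition <= 18 * ((#|V| + k) * D * (depth V).+1)].
Proof.
move=> D0V leD nk0; rewrite /max_partition value_bind cost_bind.
have := push_allP D0V leD; move: (push_all V k) => s [ff le c1].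
rewrite value_bind cost_bind.
have := augment_allP ff le; move: (augment_all _) => s' [ff' cf c2].
rewrite /= addn0; split=> //; first exact: partitionable_covered.
apply: (@leq_trans (push_cost V k D + D.+1 * round_cost V k)); first exact: leq_add.
set N := #|V| + k in nk0 *; set q := depth V.
have b1 : push_cost V k D <= D * (N * (6 * q.+1)).
  have -> : push_cost V k D = D * ((q + 3) * #|V| + k + #|V|.+1).
    by rewrite /push_cost -/q; ring.
  have qn : q * #|V| <= q * N by rewrite leq_mul2l leq_addr orbT.
  rewrite leq_mul2l; apply/orP; right.
  have -> : N * (6 * q.+1) = q * N + 5 * N + N + 5 * (q * N) by ring.
  by rewrite mulnDl; lia.
have b2 : round_cost V k <= N * (6 * q.+1).
  have qn : q * #|V| <= q * N by rewrite leq_mul2l leq_addr orbT.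
  have -> : N * (6 * q.+1) = q * N + 5 * N + N + 5 * (q * N) by ring.
  by rewrite /round_cost /explore_cost -/q; lia.
have b3 : D.+1 * round_cost V k <= 2 * D * (N * (6 * q.+1)).
  by apply: leq_mul => //; lia.
have -> : 18 * (N * D * q.+1) = D * (N * (6 * q.+1)) + 2 * D * (N * (6 * q.+1)).
  by ring.
exact: leq_add.
Qed.

Lemma max_partition_algP :
  [/\ partitionable M (output M max_partition_alg),
      #|output M max_partition_alg| = max_partitionable M
    & exists2 D, D * D <= 4 * maxn (max_partitionable M) 1 &
      num_queries M max_partition_alg <= 18 * ((#|V| + k) * D * (depth V).+1)].
Proof.
have [D [D0V leD Dle]] := ceil_sqrt.
rewrite /max_partition_alg; case: posnP => [nk0|nk0] /=; last first.
  rewrite output_compile num_queries_compile.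
  by have [p1 p2 p3] := max_partitionP D0V leD nk0; split=> //; exists D.
have [f0 f1] : #|V| = 0 /\ k = 0 by lia.
have noI (i : 'I_k) : False by case: i => i; rewrite f1.
have -> : set0 = covered ([ffun=> None] : assignment V k).
  by apply/setP => v; rewrite !inE ffunE.
have ff : feasible M [ffun=> None] by move=> i; case: (noI i).
split; [exact: partitionable_covered| |by exists D].
apply/eqP; rewrite eqn_leq card_covered_max //.
by rewrite (leq_trans max_partitionable_card) // f0.
Qed.

(** For [n = #|V| >= 2] the power [2 ^ depth V] is below [2 * n], and [4 * n <= n ^ 3]. Logarithms
    turn this into a bound on [depth V + 1]. *)
Lemma expn_depth_leq : 2 ^ (depth V).+1 <= maxn #|V| 2 ^ 3.
Proof.
have [lt1|le1] := ltnP 1 #|V|; last first.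
  rewrite (maxn_idPr _) ?(leq_trans le1) // /depth.
  by case: #|V| le1 => [|[]].
rewrite (maxn_idPl lt1) /depth.
have := up_log_gtn (isT : 1 < 2) lt1; have : 0 < up_log 2 #|V| by rewrite up_log_gt0.
case: (up_log 2 #|V|) => // q _ /=; rewrite !expnS; nia.
Qed.

End Algorithm.

Local Open Scope ring_scope.

(* For p >= 1 and n >= 2 the two truncations do nothing. For p = 0 or n <= 1
   the expression (n + k) * sqrt p * log n vanishes although queries are
   needed (with none, p = 0 cannot be told from p = 1). *)
Theorem theorem6 (R : realType) :
  exists (C : R) (alg : forall (V : finType) (k : nat), rank_algorithm V k),
  forall (V : finType) (k : nat) (M : 'I_k -> matroid V),
    let n := #|V| in
    let p := max_partitionable M in
    [/\ partitionable M (output M (alg V k)),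
        #|output M (alg V k)| = p
      & (num_queries M (alg V k))%:R <=
          C * ((n + k)%:R * Num.sqrt (maxn p 1)%:R
               * ln (maxn n 2)%:R)].
Proof.
(* 108 = 18 * 2 * 3: the query bound gives 18, [D] is at most twice the square root, and
   [depth V + 1] is at most [3 / ln 2] times the logarithm. *)
exists (108 / ln 2), max_partition_alg => V k M n p.
have [h1 h2 [D Dle le]] := max_partition_algP M; split=> //.
have ln2 : 0 < ln 2 :> R by rewrite ln_gt0 // ltr1n.
have leD : D%:R <= 2 * Num.sqrt (maxn p 1)%:R :> R.
  rewrite -[2%:R]ger0_norm // -sqrtr_sqr -sqrtrM ?exprn_ge0 //.
  rewrite -[D%:R]ger0_norm // -sqrtr_sqr; apply: ler_wsqrtr.
  by rewrite -!natrX -natrM ler_nat -mulnn.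
have le_depth : (depth V).+1%:R * ln 2 <= 3 * ln (maxn n 2)%:R :> R.
  rewrite !mulr_natl -!lnXn ?ltr0n ?leq_max ?orbT //.
  rewrite ler_ln ?posrE ?exprn_gt0 ?ltr0n ?leq_max ?orbT //.
  by rewrite -!natrX ler_nat expn_depth_leq.
apply: (@le_trans _ _ (18 * ((n + k)%:R * D%:R * (depth V).+1%:R))).
  by rewrite -!natrM ler_nat.
have -> : 108 / ln 2 * ((n + k)%:R * Num.sqrt (maxn p 1)%:R * ln (maxn n 2)%:R)
  = 18 * ((n + k)%:R * (2 * Num.sqrt (maxn p 1)%:R) * (3 * ln (maxn n 2)%:R / ln 2)) :> R.
  by rewrite (_ : 108 = 18 * 2 * 3 :> R) -?natrM //; ring.
by rewrite ler_wpM2l // ler_pM ?mulr_ge0 // ?ler_wpM2l // ler_pdivlMr.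
Qed.
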